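(* Let $a,b>0$. For $x\in(0,1)$ let \[ Q_{a,b}(x):=a\int_0^1 y^{a-1}(1-xy)^{b-1}\,\mathrm{d}y \] and \begin{align*} Q_{a,b}^{[1]}(x)&:=\Bigl(1-\frac{ax}{a+1}\Bigr)^{b-1},\\ Q_{a,b}^{[2]}(x)&:=(1-x)^{b-1}+\frac{(b-1)x}{a+1}\Bigl(1-\frac{(a+1)x}{a+2}\Bigr)^{b-2},\\ Q_{a,b}^{[3]}(x)&:=\frac{1}{(a+1)^2}+\frac{a(a+2)}{(a+1)^2}\Bigl(1-\frac{(a+1)x}{a+2}\Bigr)^{b-1},\\ Q_{a,b}^{[4]}(x)&:=\frac{a(1-x)^{b-1}+1}{a+1}-\frac{a(b-1)(b-2)x^2}{2(a+1)(a+2)}\Bigl(1-\frac{2(a+2)x}{3(a+3)}\Bigr)^{b-3},\\ Q_{a,b}^{[5]}(x)&:=\frac{a(1-x)^{b-1}+1}{a+1}-\frac{a(b-1)(b-2)x^2\bigl(a+5+2(a+2)(1-x)^{b-3}\bigr)}{6(a+1)(a+2)(a+3)}. \end{align*} Then for every $x\in(0,1)$: \begin{itemize} \item $Q_{a,b}(x)\ge Q_{a,b}^{[1]}(x)$ if $b\in(0,1]\cup[2,\infty)$, and $Q_{a,b}(x)\le Q_{a,b}^{[1]}(x)$ if $b\in[1,2]$; \item $Q_{a,b}(x)\le Q_{a,b}^{[2]}(x)$ if $b\in(0,1]\cup[2,3]$, and $Q_{a,b}(x)\ge Q_{a,b}^{[2]}(x)$ if $b\in[1,2]\cup[3,\infty)$;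 \item $Q_{a,b}(x)\ge Q_{a,b}^{[3]}(x)$ if $b\in(0,1]\cup[2,3]$, and $Q_{a,b}(x)\le Q_{a,b}^{[3]}(x)$ if $b\in[1,2]\cup[3,\infty)$; \item $Q_{a,b}(x)\le Q_{a,b}^{[4]}(x)$ if $b\in(0,1]\cup[2,3]\cup[4,\infty)$, and $Q_{a,b}(x)\ge Q_{a,b}^{[4]}(x)$ if $b\in[1,2]\cup[3,4]$; \item $Q_{a,b}(x)\ge Q_{a,b}^{[5]}(x)$ if $b\in(0,1]\cup[2,3]\cup[4,\infty)$, and $Q_{a,b}(x)\le Q_{a,b}^{[5]}(x)$ if $b\in[1,2]\cup[3,4]$. \end{itemize} *)

(* Defs.v *)
From HB Require Import structures.
From mathcomp Require Import all_boot all_order all_algebra.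
From mathcomp Require Import all_classical all_reals all_analysis.

Set Implicit Arguments.
Unset Strict Implicit.
Unset Printing Implicit Defensive.

Import Order.TTheory GRing.Theory Num.Theory.
Import numFieldNormedType.Exports.

Local Open Scope classical_set_scope.
Local Open Scope ring_scope.

(* The integrand is unbounded near 0 when a < 1, so the integral is a Lebesgue
   integral; the value that powR assigns at y = 0 does not matter. For
   0 < x < 1 every base of a real power is positive for 0 < y <= 1. *)
Definition Q (R : realType) (a b x : R) : R :=
  a * \int[lebesgue_measure]_(y in `[0, 1])
        (y `^ (a - 1) * (1 - x * y) `^ (b - 1)).

Definition Q1 (R : realType) (a b x : R) : R :=
  (1 - a * x / (a + 1)) `^ (b - 1).

Definition Q2 (R : realType) (a b x : R) : R :=
  (1 - x) `^ (b - 1)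
  + (b - 1) * x / (a + 1) * (1 - (a + 1) * x / (a + 2)) `^ (b - 2).

Definition Q3 (R : realType) (a b x : R) : R :=
  1 / (a + 1) ^+ 2
  + a * (a + 2) / (a + 1) ^+ 2 * (1 - (a + 1) * x / (a + 2)) `^ (b - 1).

Definition Q4 (R : realType) (a b x : R) : R :=
  (a * (1 - x) `^ (b - 1) + 1) / (a + 1)
  - a * (b - 1) * (b - 2) * x ^+ 2 / (2 * (a + 1) * (a + 2))
    * (1 - 2 * (a + 2) * x / (3 * (a + 3))) `^ (b - 3).

Definition Q5 (R : realType) (a b x : R) : R :=
  (a * (1 - x) `^ (b - 1) + 1) / (a + 1)
  - a * (b - 1) * (b - 2) * x ^+ 2
    * (a + 5 + 2 * (a + 2) * (1 - x) `^ (b - 3))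
    / (6 * (a + 1) * (a + 2) * (a + 3)).

(* Main.v *)
Require Import Defs.
From HB Require Import structures.
From mathcomp Require Import all_boot all_order all_algebra.
From mathcomp Require Import all_classical all_reals all_analysis.
From mathcomp Require Import measurable_realfun ring lra.

Set Implicit Arguments.
Unset Strict Implicit.
Unset Printing Implicit Defensive.

Import Order.TTheory GRing.Theory Num.Theory.
Import numFieldNormedType.Exports.

Local Open Scope classical_set_scope.
Local Open Scope ring_scope.

(** Put f y := (1 - x y)^(b-1) and let E f be the mean of f against the
    probability density a y^(a-1) on [0, 1] (the Beta(a, 1) law), so that
    Q a b x = E f and E (y^k) = a / (a + k).  Each of Q1, ..., Q5 is what E gives
    on a polynomial of degree at most 3 that lies on one side of f on the whole
    of [0, 1]; the side is decided by the sign of one derivative of f, that is by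
    the sign of (b-1)(b-2)...(b-k).

    - Q1 (f'' signed): the polynomial is the tangent line of f at the mean
      a/(a+1); this is Jensen's inequality, [beta_mean_ge_mean].
    - Q2 (f''' signed): f' lies above its tangent at c = (a+1)/(a+2), and this is
      integrated from the endpoint 1, [beta_mean_le_end].  The node c is the mean
      of the Beta(a+1, 1) law, which appears when E f is integrated by parts.
    - Q3 (f''' signed): the polynomial is the quadratic Hermite interpolant of f
      at the nodes 0, c, c with the same c; E then becomes the Gauss-Radau rule
      with a fixed node at 0, [beta_mean_ge_radau].
    - Q4 and Q5 (f'''' signed): E f is compared with the trapezoidal value
      (a f(1) + f(0)) / (a+1).  If p is a cubic with p'' <= f'' then f - p is
      convex, hence below its chord, which bounds f above by a cubic; p'' >= f''
      gives the opposite bound.  Taking for p'' the tangent of f'' at m gives Q4,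
      [beta_mean_le_trapezoid_mean], and the chord of f'' gives Q5,
      [beta_mean_ge_trapezoid_chord].

    The rules are proved for an arbitrary f whose relevant derivative is
    nonnegative, and are then applied to s f with s = 1 or s = -1. *)

(** * Convexity and interpolation on the unit interval *)

(** The derivative is two-sided even at 0 and 1: the quadrature rules evaluate
    derivatives at these nodes, and the functions of interest extend smoothly
    beyond the interval. *)
Definition is_derive01 (R : realType) (f f1 : R -> R) : Prop :=
  forall t : R, 0 <= t <= 1 -> is_derive t (1 : R) f (f1 t).

Lemma is_derive01_continuous (R : realType) (f f1 : R -> R) :
  is_derive01 f f1 -> {within `[0, 1], continuous f}.
Proof.
move=> df; apply: derivable_within_continuous => t.
by rewrite in_itv/= => /df[].
Qed.

Lemma is_derive01_MVT (R : realType) (f f1 : R -> R) (u v : R) :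
  is_derive01 f f1 -> 0 <= u -> u < v -> v <= 1 ->
  exists2 xi, u < xi < v & f v - f u = f1 xi * (v - u).
Proof.
move=> df u0 uv v1.
have sub t : u <= t <= v -> 0 <= t <= 1.
  by move=> /andP[ut tv]; rewrite (le_trans u0 ut) (le_trans tv v1).
have [|| xi xiuv fE] := @MVT R f f1 u v uv.
- move=> t; rewrite in_itv/= => /andP[/ltW ut /ltW tv].
  by apply/df/sub/andP.
- by apply: derivable_within_continuous => t; rewrite in_itv/= => /sub/df[].
- by exists xi => //; move: xiuv; rewrite in_itv.
Qed.

Lemma derive01_ge0_le (R : realType) (f f1 : R -> R) (u v : R) :
  is_derive01 f f1 -> (forall t : R, 0 <= t <= 1 -> 0 <= f1 t) ->
  0 <= u -> u <= v -> v <= 1 -> f u <= f v.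
Proof.
move=> df f1_ge0 u0; rewrite le_eqVlt => /predU1P[-> //|uv] v1.
have [xi /andP[/ltW uxi /ltW xiv] fE] := is_derive01_MVT df u0 uv v1.
rewrite -subr_ge0 fE mulr_ge0 ?subr_ge0 ?(ltW uv)// f1_ge0//.
by rewrite (le_trans u0 uxi) (le_trans xiv v1).
Qed.

Lemma tangent_le (R : realType) (f f1 f2 : R -> R) (c y : R) :
  is_derive01 f f1 -> is_derive01 f1 f2 ->
  (forall t : R, 0 <= t <= 1 -> 0 <= f2 t) ->
  0 <= c <= 1 -> 0 <= y <= 1 -> f c + f1 c * (y - c) <= f y.
Proof.
move=> df df1 f2_ge0 /andP[c0 c1] /andP[y0 y1].
have [cy|yc|<-] := ltrgtP c y; last by rewrite subrr mulr0 addr0.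
- have [xi /andP[/ltW cxi /ltW xiy] fE] := is_derive01_MVT df c0 cy y1.
  have := derive01_ge0_le df1 f2_ge0 c0 cxi (le_trans xiy y1); nra.
- have [xi /andP[/ltW yxi /ltW xic] fE] := is_derive01_MVT df y0 yc c1.
  have := derive01_ge0_le df1 f2_ge0 (le_trans y0 yxi) xic c1; nra.
Qed.

(** The two tangent inequalities at [y], towards [u] and towards [v], add up to
    this with the weights that cancel the slope. *)
Lemma chord_ge (R : realType) (f f1 f2 : R -> R) (u v y : R) :
  is_derive01 f f1 -> is_derive01 f1 f2 ->
  (forall t : R, 0 <= t <= 1 -> 0 <= f2 t) ->
  0 <= u -> u <= y -> y <= v -> v <= 1 ->
  (v - u) * f y <= (v - y) * f u + (y - u) * f v.
Proof.
move=> df df1 f2_ge0 u0 uy yv v1.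
have y01 : 0 <= y <= 1 by rewrite (le_trans u0 uy) (le_trans yv v1).
have u01 : 0 <= u <= 1 by rewrite u0 (le_trans uy)// (le_trans yv v1).
have v01 : 0 <= v <= 1 by rewrite v1 (le_trans _ yv)// (le_trans u0 uy).
have /(ler_wpM2l (_ : 0 <= v - y)) := tangent_le df df1 f2_ge0 y01 u01.
have /(ler_wpM2l (_ : 0 <= y - u)) := tangent_le df df1 f2_ge0 y01 v01.
by rewrite !subr_ge0 => /(_ uy) + /(_ yv); lra.
Qed.

(** Sign of the error of interpolation at 0, c, c: the classical remainder is
    g'''(xi) y (y - c)^2 / 6.  Here the sign comes from the convexity of g'.
    If g y < 0, the mean value theorem makes g' take, at three ordered points
    including c, values that violate the chord inequality. *)
Lemma hermite_zero_ge0 (R : realType) (g g1 g2 g3 : R -> R) (c y : R) :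
  is_derive01 g g1 -> is_derive01 g1 g2 -> is_derive01 g2 g3 ->
  (forall t : R, 0 <= t <= 1 -> 0 <= g3 t) ->
  0 < c < 1 -> g 0 = 0 -> g c = 0 -> g1 c = 0 ->
  0 <= y <= 1 -> 0 <= g y.
Proof.
move=> dg dg1 dg2 g3_ge0 /andP[c0 c1] g00 gc0 g1c0 /andP[y0 y1].
rewrite leNgt; apply/negP => gy_lt0.
have y_gt0 : 0 < y.
  rewrite lt_def y0 andbT; apply/eqP => yE.
  by move: gy_lt0; rewrite yE g00 ltxx.
have [cy|yc|yE] := ltrgtP c y; last by move: gy_lt0; rewrite -yE gc0 ltxx.
- (* g' vanishes at some xi < c and at c, but is negative at some eta > c *)
  have [xi /andP[xi0 xic]] := is_derive01_MVT dg (lexx 0) c0 (ltW c1).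
  rewrite g00 gc0 subrr subr0 => /esym/eqP.
  rewrite mulf_eq0 (gt_eqF c0) orbF => /eqP g1xi0.
  have [eta /andP[ceta etay]] := is_derive01_MVT dg (ltW c0) cy y1.
  rewrite gc0 subr0 => etaE.
  have g1eta_lt0 : g1 eta < 0.
    by move: gy_lt0; rewrite etaE pmulr_llt0 ?subr_gt0.
  have := chord_ge dg1 dg2 g3_ge0 (ltW xi0) (ltW xic) (ltW ceta)
    (ltW (lt_le_trans etay y1)).
  by rewrite g1c0 g1xi0 !mulr0 add0r pmulr_rge0 ?subr_gt0// leNgt g1eta_lt0.
- (* g' is negative at xi < y, positive at eta > y and vanishes at c > eta *)
  have [xi /andP[xi0 xiy]] := is_derive01_MVT dg (lexx 0) y_gt0 y1.
  rewrite g00 !subr0 => xiE.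
  have g1xi_lt0 : g1 xi < 0 by move: gy_lt0; rewrite xiE pmulr_llt0.
  have [eta /andP[yeta etac]] := is_derive01_MVT dg y0 yc (ltW c1).
  rewrite gc0 sub0r => etaE.
  have g1eta_gt0 : 0 < g1 eta.
    by move: gy_lt0; rewrite -oppr_gt0 etaE pmulr_lgt0 ?subr_gt0.
  have := chord_ge dg1 dg2 g3_ge0 (ltW xi0) (ltW (lt_trans xiy yeta)) (ltW etac)
    (ltW c1).
  rewrite g1c0 mulr0 addr0 leNgt => /negP; apply.
  apply: (@lt_trans _ _ 0).
    by rewrite pmulr_rlt0 ?subr_gt0.
  by rewrite pmulr_rgt0 ?subr_gt0 ?(lt_trans xiy).
Qed.

(** * Means and moments of the Beta(a, 1) law *)

(** For c < 1 the integrand blows up at 0, so the fundamental theorem of calculus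
    is applied on [1/(n+2), 1] and monotone convergence gives the limit. *)
Lemma integral_powRB1 (R : realType) (c : R) : 0 < c ->
  (\int[lebesgue_measure]_(y in `[0%R, 1%R]) (y `^ (c - 1))%:E = (c^-1)%:E)%E.
Proof.
move=> c0.
pose e n : R := n.+2%:R^-1.
have e0 n : 0 < e n by rewrite invr_gt0.
have e1 n : e n < 1 by rewrite invf_lt1// ltr1n.
pose F n := `[e n, 1%R]%classic.
have FTC n : (\int[lebesgue_measure]_(y in F n) (y `^ (c - 1))%:E
    = (1 / c - (e n) `^ c / c)%:E)%E.
  have dpow t : e n <= t ->
      is_derive t (1 : R) (fun y => y `^ c / c) (t `^ (c - 1)).
    move=> et; have t0 := lt_le_trans (e0 n) et; have ? := is_derive1_powR c t0.
    by apply: is_derive_eq; rewrite /GRing.scale/=; field; rewrite gt_eqF.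
  have cpow : {within `[e n, 1], continuous (fun y : R => y `^ c / c)}.
    apply: derivable_within_continuous => t; rewrite in_itv/= => /andP[et _].
    by have [] := dpow _ et.
  rewrite EFinB (@continuous_FTC2 R _ (fun y => y `^ c / c))//.
  - by rewrite powR1.
  - apply: derivable_within_continuous => t; rewrite in_itv/= => /andP[et _].
    by apply: derivable_powR; rewrite in_itv/= andbT (lt_le_trans (e0 n)).
  - have /(continuous_within_itvP _ (e1 n))[_ cl cr] := cpow.
    split => // t; rewrite in_itv/= => /andP[/ltW et _].
    by have [] := dpow _ et.
  - move=> t; rewrite in_itv/= => /andP[/ltW et _].
    by rewrite derive1E; have [_ ->] := dpow _ et.
have FU : \bigcup_n F n = `]0%R, 1%R]%classic.
  apply/seteqP; split => [y [n _]|y]; rewrite /F /= !in_itv/=.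
    by move=> /andP[ey ->]; rewrite (lt_le_trans (e0 n)).
  move=> /andP[y0 y1]; exists (Num.truncn y^-1) => //=.
  rewrite in_itv/= y1 andbT -[leRHS]invrK /e lef_pV2 ?posrE ?invr_gt0//.
  have := truncnS_gt y^-1; move/ltW/le_trans; apply; by rewrite ler_nat.
rewrite -integral_itv_obnd_cbnd; last first.
  apply/measurable_EFinP/measurable_funTS; exact: measurable_powR.
rewrite -FU.
have FTCcvg : (\int[lebesgue_measure]_(y in F n) (y `^ (c - 1))%:E
    @[n --> \oo] --> (c^-1)%:E)%E.
  under eq_fun do rewrite FTC.
  apply: cvg_EFin; first exact: nearW.
  rewrite [X in _ --> X](_ : _ = 1 / c - 0 / c); last first.
    by rewrite div1r mul0r subr0.
  apply: (@cvgB _ _ _ _ _ (fun=> 1 / c) (fun n => e n `^ c / c)).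
    exact: cvg_cst.
  apply: cvgM; last exact: cvg_cst.
  have /cvg_at_rightP/(_ e) := powR_cvg0 c0; apply; split=> //.
  by have := @cvg_harmonic R; rewrite -cvg_shiftS; exact.
suff : (\int[lebesgue_measure]_(y in F n) (y `^ (c - 1))%:E @[n --> \oo] -->
    \int[lebesgue_measure]_(y in \bigcup_n F n) (y `^ (c - 1))%:E)%E.
  by move=> /cvg_unique; apply.
apply: (@ge0_nondecreasing_set_cvg_integral _ (measurableTypeR R) R F
  (fun y => (y `^ (c - 1))%:E)) => //.
- apply/nondecreasing_seqP => n; rewrite subsetEset => y.
  rewrite /F /= !in_itv/= => /andP[ey ->]; rewrite andbT (le_trans _ ey)//.
  by rewrite lef_pV2 ?posrE// ler_nat.
- by move=> n; apply: measurable_itv.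
- move=> n; apply/measurable_EFinP/measurable_funTS; exact: measurable_powR.
- by move=> n y _; rewrite lee_fin powR_ge0.
Qed.

(** The expectation of [f] under the Beta(a, 1) law. *)
Definition beta_mean (R : realType) (a : R) (f : R -> R) : R :=
  a * \int[lebesgue_measure]_(y in `[0, 1]) (y `^ (a - 1) * f y).

(** A continuous factor is bounded on [0, 1], so the integrable density
    dominates. *)
Lemma integrable_powRB1M (R : realType) (a : R) (f : R -> R) : 0 < a ->
  {within `[0, 1], continuous f} ->
  (@lebesgue_measure R).-integrable `[0, 1]
    (EFin \o (fun y : R => y `^ (a - 1) * f y)).
Proof.
move=> a0 cf.
have mpow : measurable_fun `[0%R : R, 1%R] (fun y : R => y `^ (a - 1)).
  by apply: measurable_funTS; exact: measurable_powR.
have mf : measurable_fun `[0%R : R, 1%R] f.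
  exact: subspace_continuous_measurable_fun.
have cnf : {within `[0, 1], continuous (fun y => `|f y|)}.
  by move=> y; apply: cvg_norm; exact: cf.
have [m _ mmax] := EVT_max ler01 cnf.
have ipow : (@lebesgue_measure R).-integrable `[0%R : R, 1%R]
    (fun y : R => (y `^ (a - 1))%:E).
  apply/integrableP; split; first exact/measurable_EFinP.
  under eq_integral => y _ do rewrite gee0_abs ?lee_fin ?powR_ge0//.
  by rewrite integral_powRB1// ltry.
apply: (le_integrable _ _ _ (integrableZl _ `|f m| ipow)) => //.
- by apply/measurable_EFinP; exact: measurable_funM.
- move=> y y01; rewrite /= lee_fin normrM mulrC normrM normr_id.
  by rewrite ler_wpM2r// mmax.
Qed.

Lemma ler_beta_mean (R : realType) (a : R) (f g : R -> R) : 0 < a ->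
  {within `[0, 1], continuous f} -> {within `[0, 1], continuous g} ->
  (forall y : R, 0 <= y <= 1 -> f y <= g y) -> beta_mean a f <= beta_mean a g.
Proof.
move=> a0 cf cg fg; apply: ler_wpM2l; first exact: ltW.
apply: le_Rintegral => //; [exact: integrable_powRB1M..|].
move=> y; rewrite /= in_itv/= => y01.
by rewrite ler_wpM2l ?powR_ge0 ?fg.
Qed.

Lemma beta_meanD (R : realType) (a : R) (f g : R -> R) : 0 < a ->
  {within `[0, 1], continuous f} -> {within `[0, 1], continuous g} ->
  beta_mean a (fun y => f y + g y) = beta_mean a f + beta_mean a g.
Proof.
move=> a0 cf cg; rewrite /beta_mean -mulrDr -RintegralD//;
  do 2?exact: integrable_powRB1M.
by under eq_Rintegral do rewrite mulrDr.
Qed.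

Lemma beta_meanZ (R : realType) (a k : R) (f : R -> R) : 0 < a ->
  {within `[0, 1], continuous f} ->
  beta_mean a (fun y => k * f y) = k * beta_mean a f.
Proof.
move=> a0 cf; rewrite /beta_mean [RHS]mulrCA; congr (_ * _).
rewrite -RintegralZl//; last first.
  exact: integrable_powRB1M.
by under eq_Rintegral do rewrite mulrCA.
Qed.

Lemma beta_mean_exp (R : realType) (a : R) (k : nat) : 0 < a ->
  beta_mean a (fun y => y ^+ k) = a / (a + k%:R).
Proof.
move=> a0; rewrite /beta_mean; congr (_ * _).
have -> : (a + k%:R)^-1 = fine (a + k%:R)^-1%:E by [].
rewrite -integral_powRB1 ?ltr_wpDr//; apply: eq_Rintegral => y.
rewrite inE/= in_itv/= => /andP[y0 _].
case: k => [|k]; first by rewrite expr0 mulr1 addr0.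
rewrite -powR_mulrn// addrAC.
(* at y = 0 both sides vanish, because a + k > 0 *)
have [->|y_neq0] := eqVneq y 0; last by rewrite -powRD// y_neq0 implybT.
have -> : 0 `^ k.+1%:R = 0 :> R by rewrite powR0// pnatr_eq0.
rewrite mulr0 powR0// gt_eqF//.
by have := ler0n R k; rewrite -natr1; lra.
Qed.

Lemma beta_mean_cubic (R : realType) (a c0 c1 c2 c3 : R) : 0 < a ->
  beta_mean a (fun y => c0 + c1 * y + c2 * y ^+ 2 + c3 * y ^+ 3) =
  c0 + c1 * (a / (a + 1)) + c2 * (a / (a + 2)) + c3 * (a / (a + 3)).
Proof.
move=> a0.
have cont (f : R -> R) : continuous f -> {within `[0, 1], continuous f}.
  exact: continuous_subspaceT.
have cX k : {within `[0, 1], continuous (fun y : R => y ^+ k)}.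
  by apply: cont; exact: exprn_continuous.
have cZ k c : {within `[0, 1], continuous (fun y : R => c * y ^+ k)}.
  by move=> y; apply: cvgM; [exact: cvg_cst|exact: cX].
have cD (f g : R -> R) : {within `[0, 1], continuous f} ->
    {within `[0, 1], continuous g} ->
    {within `[0, 1], continuous (fun y : R => f y + g y)}.
  by move=> cf cg y; apply: cvgD; [exact: cf|exact: cg].
have -> : (fun y => c0 + c1 * y + c2 * y ^+ 2 + c3 * y ^+ 3) =
    (fun y => c0 * y ^+ 0 + c1 * y ^+ 1 + c2 * y ^+ 2 + c3 * y ^+ 3).
  by apply/funext => y; rewrite expr0 mulr1.
rewrite !beta_meanD//; do ?[exact: cZ | apply: (cD)].
by rewrite !beta_meanZ// !beta_mean_exp// addr0 divff ?gt_eqF// mulr1.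
Qed.

(** * Quadrature inequalities *)

Lemma beta_mean_ge_cubic (R : realType) (a : R) (f f1 : R -> R)
    (c0 c1 c2 c3 : R) :
  0 < a -> is_derive01 f f1 ->
  (forall y : R, 0 <= y <= 1 ->
    c0 + c1 * y + c2 * y ^+ 2 + c3 * y ^+ 3 <= f y) ->
  c0 + c1 * (a / (a + 1)) + c2 * (a / (a + 2)) + c3 * (a / (a + 3))
    <= beta_mean a f.
Proof.
move=> a_gt0 df le_f; rewrite -beta_mean_cubic//; apply: ler_beta_mean => //.
- by apply: derivable_within_continuous => t _; apply: ex_derive.
- exact: is_derive01_continuous df.
Qed.

Lemma beta_mean_le_cubic (R : realType) (a : R) (f f1 : R -> R)
    (c0 c1 c2 c3 : R) :
  0 < a -> is_derive01 f f1 ->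
  (forall y : R, 0 <= y <= 1 ->
    f y <= c0 + c1 * y + c2 * y ^+ 2 + c3 * y ^+ 3) ->
  beta_mean a f <=
    c0 + c1 * (a / (a + 1)) + c2 * (a / (a + 2)) + c3 * (a / (a + 3)).
Proof.
move=> a_gt0 df f_le; rewrite -beta_mean_cubic//; apply: ler_beta_mean => //.
- exact: is_derive01_continuous df.
- by apply: derivable_within_continuous => t _; apply: ex_derive.
Qed.

(** Jensen's inequality. *)
Lemma beta_mean_ge_mean (R : realType) (a : R) (f f1 f2 : R -> R) :
  0 < a -> is_derive01 f f1 -> is_derive01 f1 f2 ->
  (forall t : R, 0 <= t <= 1 -> 0 <= f2 t) ->
  f (a / (a + 1)) <= beta_mean a f.
Proof.
move=> a_gt0 df df1 f2_ge0; set c := a / (a + 1).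
have c01 : 0 <= c <= 1.
  by rewrite /c divr_ge0 ?ler_pdivrMr //=; lra.
have := @beta_mean_ge_cubic R a f f1 (f c - f1 c * c) (f1 c) 0 0 a_gt0 df.
rewrite !mul0r !addr0 -/c subrK; apply => y y01.
have := tangent_le df df1 f2_ge0 c01 y01; lra.
Qed.

(** The node c = (a+1)/(a+2) is the one that removes f'' c from the mean of
    f 1 - (integral from y to 1 of f' c + f'' c (t - c)), the bound for f y
    obtained from the tangent of f'. *)
Lemma beta_mean_le_end (R : realType) (a : R) (f f1 f2 f3 : R -> R) :
  0 < a -> is_derive01 f f1 -> is_derive01 f1 f2 -> is_derive01 f2 f3 ->
  (forall t : R, 0 <= t <= 1 -> 0 <= f3 t) ->
  beta_mean a f <= f 1 - f1 ((a + 1) / (a + 2)) / (a + 1).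
Proof.
move=> a_gt0 df df1 df2 f3_ge0; set c := (a + 1) / (a + 2).
have c01 : 0 <= c <= 1.
  by rewrite /c divr_ge0 ?ler_pdivrMr //=; lra.
pose g y := f y - (f1 c * y + f2 c * (y ^+ 2 / 2 - c * y)).
have dg : is_derive01 g (fun y => f1 y - (f1 c + f2 c * (y - c))).
  move=> t t01; have ? := df t t01; apply: is_derive_eq.
  by rewrite /GRing.scale/=; field.
apply: le_trans (@beta_mean_le_cubic R a f f1
  (f 1 - f1 c - f2 c / 2 * (1 - 2 * c)) (f1 c - f2 c * c) (f2 c / 2) 0
  a_gt0 df _) _.
- move=> y y01; have /andP[y0 y1] := y01.
  have := derive01_ge0_le dg _ y0 y1 (lexx 1); rewrite /g => H.
  suff : forall t, 0 <= t <= 1 -> 0 <= f1 t - (f1 c + f2 c * (t - c)).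
    by move=> /H; lra.
  by move=> t t01; have := tangent_le df1 df2 f3_ge0 c01 t01; lra.
- rewrite le_eqVlt; apply/orP; left; apply/eqP; rewrite /c; field.
  by apply/and3P; split; rewrite gt_eqF//; lra.
Qed.

(** The mean of y (y - c) vanishes for c = (a+1)/(a+2), so the coefficient of
    this term in the Newton form of the Hermite interpolant, which carries f' c,
    drops out and only f 0 and f c remain. *)
Lemma beta_mean_ge_radau (R : realType) (a : R) (f f1 f2 f3 : R -> R) :
  0 < a -> is_derive01 f f1 -> is_derive01 f1 f2 -> is_derive01 f2 f3 ->
  (forall t : R, 0 <= t <= 1 -> 0 <= f3 t) ->
  f 0 / (a + 1) ^+ 2 + a * (a + 2) / (a + 1) ^+ 2 * f ((a + 1) / (a + 2))
    <= beta_mean a f.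
Proof.
move=> a_gt0 df df1 df2 f3_ge0; set c := (a + 1) / (a + 2).
have c01 : 0 < c < 1.
  by rewrite /c divr_gt0 ?ltr_pdivrMr //=; lra.
(* D and E are the divided differences at the nodes 0, c and 0, c, c *)
pose D := (f c - f 0) / c; pose E := (f1 c - D) / c.
pose g y := f y - (f 0 + D * y + E * (y ^+ 2 - c * y)).
pose g1 y := f1 y - (D + E * (2 * y - c)).
have dg : is_derive01 g g1.
  move=> t t01; have ? := df t t01; apply: is_derive_eq.
  by rewrite /g1 /GRing.scale/=; ring.
have dg1 : is_derive01 g1 (fun y => f2 y - 2 * E).
  move=> t t01; have ? := df1 t t01; apply: is_derive_eq.
  by rewrite /GRing.scale/=; ring.
have dg2 : is_derive01 (fun y => f2 y - 2 * E) f3.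
  move=> t t01; have ? := df2 t t01; apply: is_derive_eq.
  by ring.
have c_neq0 : c != 0 by lra.
have g_ge0 y : 0 <= y <= 1 -> 0 <= g y.
  apply: (hermite_zero_ge0 dg dg1 dg2 f3_ge0 c01); rewrite /g /g1 /E /D.
  - by field.
  - by field.
  - by field.
apply: le_trans (@beta_mean_ge_cubic R a f f1 (f 0) (D - E * c) E 0 a_gt0 df _).
- rewrite le_eqVlt; apply/orP; left; apply/eqP; rewrite /E /D.
  generalize (f c), (f1 c) => fc f1c; rewrite /c; field.
  by do ?[apply/andP; split]; rewrite gt_eqF//; lra.
- by move=> y /g_ge0; rewrite /g; lra.
Qed.

(** The error of the trapezoidal rule is the mean of f'' against a negative
    kernel of total mass - a / (2 (a+1) (a+2)) and barycentre m; choosing the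
    tangent of f'' at this m makes the contribution of f''' m vanish. *)
Lemma beta_mean_le_trapezoid_mean (R : realType) (a : R)
    (f f1 f2 f3 f4 : R -> R) :
  0 < a -> is_derive01 f f1 -> is_derive01 f1 f2 -> is_derive01 f2 f3 ->
  is_derive01 f3 f4 -> (forall t : R, 0 <= t <= 1 -> 0 <= f4 t) ->
  beta_mean a f <= (a * f 1 + f 0) / (a + 1)
    - a / (2 * (a + 1) * (a + 2)) * f2 (2 * (a + 2) / (3 * (a + 3))).
Proof.
move=> a_gt0 df df1 df2 df3 f4_ge0; set m := 2 * (a + 2) / (3 * (a + 3)).
have m01 : 0 <= m <= 1.
  by rewrite /m divr_ge0 ?ler_pdivrMr //=; lra.
pose F := f2 m; pose G := f3 m.
(* the subtracted cubic has second derivative F + G * (y - m) *)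
pose g y := f y - (F * y ^+ 2 / 2 + G * (y ^+ 3 / 6 - m * y ^+ 2 / 2)).
pose g1 y := f1 y - (F * y + G * (y ^+ 2 / 2 - m * y)).
have dg : is_derive01 g g1.
  move=> t t01; have ? := df t t01; apply: is_derive_eq.
  by rewrite /g1 /GRing.scale/=; field.
have dg1 : is_derive01 g1 (fun y => f2 y - (F + G * (y - m))).
  move=> t t01; have ? := df1 t t01; apply: is_derive_eq.
  by rewrite /GRing.scale/=; field.
have g2_ge0 y : 0 <= y <= 1 -> 0 <= f2 y - (F + G * (y - m)).
  by move=> y01; rewrite subr_ge0; apply: tangent_le df2 df3 f4_ge0 m01 y01.
apply: le_trans (@beta_mean_le_cubic R a f f1 (f 0)
  (f 1 - f 0 - F / 2 - G * (6^-1 - m / 2)) (F / 2 - G * m / 2) (G / 6)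
  a_gt0 df _) _.
- move=> y /andP[y0 y1].
  have := chord_ge dg dg1 g2_ge0 (lexx 0) y0 y1 (lexx 1).
  by rewrite /g; lra.
- rewrite le_eqVlt; apply/orP; left; apply/eqP.
  rewrite -/F; clearbody F G; rewrite /m; field.
  by do ?[apply/andP; split]; rewrite gt_eqF//; lra.
Qed.

(** The same kernel, with barycentre m, against the chord of f'': this splits the
    mass between f'' 0 and f'' 1 with weights 1 - m = (a+5) / (3 (a+3)) and m. *)
Lemma beta_mean_ge_trapezoid_chord (R : realType) (a : R)
    (f f1 f2 f3 f4 : R -> R) :
  0 < a -> is_derive01 f f1 -> is_derive01 f1 f2 -> is_derive01 f2 f3 ->
  is_derive01 f3 f4 -> (forall t : R, 0 <= t <= 1 -> 0 <= f4 t) ->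
  (a * f 1 + f 0) / (a + 1)
    - a * ((a + 5) * f2 0 + 2 * (a + 2) * f2 1)
      / (6 * (a + 1) * (a + 2) * (a + 3)) <= beta_mean a f.
Proof.
move=> a_gt0 df df1 df2 df3 f4_ge0.
pose A := f2 0; pose B := f2 1.
(* the cubic here has the chord of f'' as second derivative *)
pose g y := A * (y ^+ 2 / 2 - y ^+ 3 / 6) + B * (y ^+ 3 / 6) - f y.
pose g1 y := A * (y - y ^+ 2 / 2) + B * (y ^+ 2 / 2) - f1 y.
have dg : is_derive01 g g1.
  move=> t t01; have ? := df t t01; apply: is_derive_eq.
  by rewrite /g1 /GRing.scale/=; field.
have dg1 : is_derive01 g1 (fun y => A * (1 - y) + B * y - f2 y).
  move=> t t01; have ? := df1 t t01; apply: is_derive_eq.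
  by rewrite /GRing.scale/=; field.
have g2_ge0 y : 0 <= y <= 1 -> 0 <= A * (1 - y) + B * y - f2 y.
  move=> /andP[y0 y1].
  have := chord_ge df2 df3 f4_ge0 (lexx 0) y0 y1 (lexx 1).
  by rewrite /A /B; lra.
apply: le_trans (@beta_mean_ge_cubic R a f f1 (f 0)
  (f 1 - f 0 - A / 3 - B / 6) (A / 2) ((B - A) / 6) a_gt0 df _).
- rewrite le_eqVlt; apply/orP; left; apply/eqP.
  rewrite -/A -/B; field.
  by do ?[apply/andP; split]; rewrite gt_eqF//; lra.
- move=> y /andP[y0 y1].
  have := chord_ge dg dg1 g2_ge0 (lexx 0) y0 y1 (lexx 1).
  by rewrite /g; lra.
Qed.

(** * The bounds for powers of 1 - x y *)

Lemma is_derive01_powR_onem (R : realType) (x C p C' p' : R) :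
  0 < x < 1 -> C' = - (C * p * x) -> p' = p - 1 ->
  is_derive01 (fun t => C * (1 - x * t) `^ p) (fun t => C' * (1 - x * t) `^ p').
Proof.
move=> /andP[x0 x1] -> -> t /andP[t0 t1].
have base_gt0 : 0 < 1 - x * t by nra.
have dbase : is_derive t (1 : R) (fun t => 1 - x * t) (- x).
  by apply: is_derive_eq; rewrite /GRing.scale/=; ring.
have dpow : is_derive t (1 : R) (fun t => (1 - x * t) `^ p) _ :=
  @is_derive1_comp R (@powR R ^~ p) _ t _ _ (is_derive1_powR p base_gt0) dbase.
apply: is_derive_eq; rewrite /GRing.scale/=; ring.
Qed.

(** The five bounds for s Q, under a sign condition on the product of s with the
    constant of the relevant derivative of (1 - x y)^(b-1); s = 1 gives one
    direction of each bound and s = -1 the other. *)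
Section SignedBounds.
Variables (R : realType) (a b x s : R).
Hypothesis a_gt0 : 0 < a.
Hypothesis x01 : 0 < x < 1.

Let K (C p : R) : R -> R := fun t => C * (1 - x * t) `^ p.
Let C1 : R := - (s * (b - 1) * x).
Let C2 : R := s * (b - 1) * (b - 2) * x ^+ 2.
Let C3 : R := - (s * (b - 1) * (b - 2) * (b - 3)) * x ^+ 3.
Let C4 : R := s * (b - 1) * (b - 2) * (b - 3) * (b - 4) * x ^+ 4.

Let dK0 : is_derive01 (K s (b - 1)) (K C1 (b - 2)).
Proof. by apply: is_derive01_powR_onem => //; rewrite /C1; ring. Qed.

Let dK1 : is_derive01 (K C1 (b - 2)) (K C2 (b - 3)).
Proof. by apply: is_derive01_powR_onem => //; rewrite /C1 /C2; ring. Qed.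

Let dK2 : is_derive01 (K C2 (b - 3)) (K C3 (b - 4)).
Proof. by apply: is_derive01_powR_onem => //; rewrite /C2 /C3; ring. Qed.

Let dK3 : is_derive01 (K C3 (b - 4)) (K C4 (b - 5)).
Proof. by apply: is_derive01_powR_onem => //; rewrite /C3 /C4; ring. Qed.

Let K_ge0 (C p : R) : 0 <= C -> forall t : R, 0 <= t <= 1 -> 0 <= K C p t.
Proof. by move=> C_ge0 t _; rewrite /K mulr_ge0 ?powR_ge0. Qed.

Let x_gt0 : 0 < x. Proof. by case/andP: x01. Qed.

Let signed_Q : s * Q a b x = beta_mean a (K s (b - 1)).
Proof.
rewrite -beta_meanZ//.
have -> : (fun t => (1 - x * t) `^ (b - 1)) = K 1 (b - 1).
  by apply/funext => t; rewrite /K mul1r.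
exact: is_derive01_continuous (is_derive01_powR_onem x01 erefl erefl).
Qed.

Lemma signed_Q1_le : 0 <= s * (b - 1) * (b - 2) -> s * Q1 a b x <= s * Q a b x.
Proof.
move=> sgn; rewrite signed_Q.
have C2_ge0 : 0 <= C2 by rewrite /C2 mulr_ge0 ?exprn_ge0 ?(ltW x_gt0).
have := beta_mean_ge_mean a_gt0 dK0 dK1 (K_ge0 _ C2_ge0).
by rewrite /K /Q1 mulrCA mulrA.
Qed.

Lemma signed_Q2_ge :
  s * (b - 1) * (b - 2) * (b - 3) <= 0 -> s * Q a b x <= s * Q2 a b x.
Proof.
move=> sgn; rewrite signed_Q.
have C3_ge0 : 0 <= C3 by rewrite /C3 mulr_ge0 ?oppr_ge0 ?exprn_ge0 ?(ltW x_gt0).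
have := beta_mean_le_end a_gt0 dK0 dK1 dK2 (K_ge0 _ C3_ge0).
move/le_trans; apply; rewrite le_eqVlt; apply/orP; left; apply/eqP.
rewrite /K /Q2 mulr1 /C1.
have -> : x * ((a + 1) / (a + 2)) = (a + 1) * x / (a + 2) by ring.
by ring.
Qed.

Lemma signed_Q3_le :
  s * (b - 1) * (b - 2) * (b - 3) <= 0 -> s * Q3 a b x <= s * Q a b x.
Proof.
move=> sgn; rewrite signed_Q.
have C3_ge0 : 0 <= C3 by rewrite /C3 mulr_ge0 ?oppr_ge0 ?exprn_ge0 ?(ltW x_gt0).
apply: le_trans (beta_mean_ge_radau a_gt0 dK0 dK1 dK2 (K_ge0 _ C3_ge0)).
rewrite le_eqVlt; apply/orP; left; apply/eqP.
rewrite /K /Q3 mulr0 subr0 powR1.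
have -> : x * ((a + 1) / (a + 2)) = (a + 1) * x / (a + 2) by ring.
by ring.
Qed.

Lemma signed_Q4_ge : 0 <= s * (b - 1) * (b - 2) * (b - 3) * (b - 4) ->
  s * Q a b x <= s * Q4 a b x.
Proof.
move=> sgn; rewrite signed_Q.
have C4_ge0 : 0 <= C4 by rewrite /C4 mulr_ge0 ?exprn_ge0 ?(ltW x_gt0).
have := beta_mean_le_trapezoid_mean a_gt0 dK0 dK1 dK2 dK3 (K_ge0 _ C4_ge0).
move/le_trans; apply; rewrite le_eqVlt; apply/orP; left; apply/eqP.
rewrite /K /Q4 mulr0 mulr1 subr0 powR1 /C2.
have -> : x * (2 * (a + 2) / (3 * (a + 3))) = 2 * (a + 2) * x / (3 * (a + 3)).
  by ring.
ring.
Qed.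

Lemma signed_Q5_le : 0 <= s * (b - 1) * (b - 2) * (b - 3) * (b - 4) ->
  s * Q5 a b x <= s * Q a b x.
Proof.
move=> sgn; rewrite signed_Q.
have C4_ge0 : 0 <= C4 by rewrite /C4 mulr_ge0 ?exprn_ge0 ?(ltW x_gt0).
apply: le_trans (beta_mean_ge_trapezoid_chord a_gt0 dK0 dK1 dK2 dK3
  (K_ge0 _ C4_ge0)).
rewrite le_eqVlt; apply/orP; left; apply/eqP.
rewrite /K /Q5 mulr0 mulr1 subr0 !powR1 /C2.
ring.
Qed.

End SignedBounds.

Theorem theorem2p3 (R : realType) (a b : R) (ha : 0 < a) (hb : 0 < b)
    (x : R) (hx : 0 < x < 1) :
  ((0 < b <= 1 \/ 2 <= b -> Q1 a b x <= Q a b x) /\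
   (1 <= b <= 2 -> Q a b x <= Q1 a b x)) /\
  ((0 < b <= 1 \/ 2 <= b <= 3 -> Q a b x <= Q2 a b x) /\
   (1 <= b <= 2 \/ 3 <= b -> Q2 a b x <= Q a b x)) /\
  ((0 < b <= 1 \/ 2 <= b <= 3 -> Q3 a b x <= Q a b x) /\
   (1 <= b <= 2 \/ 3 <= b -> Q a b x <= Q3 a b x)) /\
  ((0 < b <= 1 \/ 2 <= b <= 3 \/ 4 <= b -> Q a b x <= Q4 a b x) /\
   (1 <= b <= 2 \/ 3 <= b <= 4 -> Q4 a b x <= Q a b x)) /\
  ((0 < b <= 1 \/ 2 <= b <= 3 \/ 4 <= b -> Q5 a b x <= Q a b x) /\
   (1 <= b <= 2 \/ 3 <= b <= 4 -> Q a b x <= Q5 a b x)).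
Proof.
(* the signs of (b-1)(b-2), (b-1)(b-2)(b-3) and (b-1)(b-2)(b-3)(b-4) *)
have low2 : b <= 1 -> 0 <= (b - 1) * (b - 2) by move=> ?; nra.
have mid2 : 1 <= b <= 2 -> (b - 1) * (b - 2) <= 0 by move=> ?; nra.
have high2 : 2 <= b -> 0 <= (b - 1) * (b - 2) by move=> ?; nra.
have low2' : b <= 3 -> 0 <= (b - 3) * (b - 4) by move=> ?; nra.
have mid2' : 3 <= b <= 4 -> (b - 3) * (b - 4) <= 0 by move=> ?; nra.
have high2' : 4 <= b -> 0 <= (b - 3) * (b - 4) by move=> ?; nra.
have neg3 : 0 < b <= 1 \/ 2 <= b <= 3 -> (b - 1) * (b - 2) * (b - 3) <= 0.
  move=> [/andP[_ b1]|/andP[b2 b3]]; apply: mulr_ge0_le0.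
  - exact: low2.
  - lra.
  - exact: high2.
  - lra.
have pos3 : 1 <= b <= 2 \/ 3 <= b -> 0 <= (b - 1) * (b - 2) * (b - 3).
  move=> [b12|b3]; first by apply: mulr_le0; [exact: mid2|lra].
  by apply: mulr_ge0; [apply: high2; lra|lra].
have pos4 : 0 < b <= 1 \/ 2 <= b <= 3 \/ 4 <= b ->
    0 <= (b - 1) * (b - 2) * ((b - 3) * (b - 4)).
  move=> [b01|[b23|b4]]; apply: mulr_ge0.
  - by apply: low2; lra.
  - by apply: low2'; lra.
  - by apply: high2; lra.
  - by apply: low2'; lra.
  - by apply: high2; lra.
  - exact: high2'.
have neg4 : 1 <= b <= 2 \/ 3 <= b <= 4 ->
    (b - 1) * (b - 2) * ((b - 3) * (b - 4)) <= 0.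
  move=> [b12|b34].
    by apply: mulr_le0_ge0; [exact: mid2|apply: low2'; lra].
  by apply: mulr_ge0_le0; [apply: high2; lra|exact: mid2'].
have Q1P s := @signed_Q1_le R a b x s ha hx.
have Q2P s := @signed_Q2_ge R a b x s ha hx.
have Q3P s := @signed_Q3_le R a b x s ha hx.
have Q4P s := @signed_Q4_ge R a b x s ha hx.
have Q5P s := @signed_Q5_le R a b x s ha hx.
split; [split|split; [split|split; [split|split; split]]].
- move=> b_in; have := Q1P 1; rewrite !mul1r; apply.
  by case: b_in => [/andP[_ /low2]|/high2].
- by move=> /mid2 sgn; have := Q1P (-1); rewrite !mulN1r lerN2; apply; lra.
- by move=> /neg3 sgn; have := Q2P 1; rewrite !mul1r; apply; lra.
- by move=> /pos3 sgn; have := Q2P (-1); rewrite !mulN1r lerN2; apply; lra.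
- by move=> /neg3 sgn; have := Q3P 1; rewrite !mul1r; apply; lra.
- by move=> /pos3 sgn; have := Q3P (-1); rewrite !mulN1r lerN2; apply; lra.
- by move=> /pos4 sgn; have := Q4P 1; rewrite !mul1r; apply; lra.
- by move=> /neg4 sgn; have := Q4P (-1); rewrite !mulN1r lerN2; apply; lra.
- by move=> /pos4 sgn; have := Q5P 1; rewrite !mul1r; apply; lra.
- by move=> /neg4 sgn; have := Q5P (-1); rewrite !mulN1r lerN2; apply; lra.
Qed.
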